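(* Let $G$ be a median graph with basepoint $v_0$, and let $u,v\in V$ with $u\in I(v_0,v)$. Then the ladder set $L_{u,v}$ is a pairwise orthogonal family. Moreover, there exists a shortest $(u,v)$-path whose first $|L_{u,v}|$ edges belong to the classes of $L_{u,v}$.
   Context: $G=(V,E)$ is a finite, simple, connected, undirected median graph: for all vertices $x,y,z$ the set $I(x,y)\cap I(y,z)\cap I(z,x)$ has exactly one element, where $I(u,v)=\{w: d(u,w)+d(w,v)=d(u,v)\}$. Edges $uv,xy$ are in relation $\Theta_0$ if $uvyx$ is a 4-cycle; $\Theta$ is the reflexive transitive closure of $\Theta_0$, with equivalence classes $E_1,\dots,E_q$ ($\Theta$-classes). For each $i$, $(V,E\setminus E_i)$ has exactly two connected components (halfspaces). Classes $E_i,E_j$ are orthogonal if there is a 4-cycle $uvyx$ with $uv,xy\in E_i$ and $ux,vy\in E_j$; a pairwise orthogonal family (POF) is a set of classes any two distinct members of which are orthogonal. The signature $\sigma_{u,v}$ is the set of classes $E_i$ such that $u,v$ lie in different halfspaces of $E_i$. For $u\in I(v_0,v)$, the ladder set $L_{u,v}$ is the set of classes in $\sigma_{u,v}$ having an edge incident to $u$. *)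

(* Defs.v *)
From mathcomp Require Import all_boot.
Set Implicit Arguments.
Unset Strict Implicit.
Unset Printing Implicit Defensive.

(* The value is #|T| when v is not reachable from u; otherwise the length of a
   shortest path is less than #|T|, so searching below #|T| suffices. *)
Definition dist (T : finType) (e : rel T) (u v : T) : nat :=
  find (fun n => [exists p : n.-tuple T, path e u p && (last u p == v)])
       (iota 0 #|T|).

Definition interval (T : finType) (e : rel T) (u v : T) : {set T} :=
  [set w | dist e u w + dist e w v == dist e u v].

Definition median_graph (T : finType) (e : rel T) : Prop :=
  [/\ symmetric e, irreflexive e, (forall x y : T, connect e x y)
    & forall x y z : T,
        #|interval e x y :&: interval e y z :&: interval e z x| = 1].

(* The undirected edge xy is represented by the unordered pair [set x; y]. *)
Definition edges (T : finType) (e : rel T) : {set {set T}} :=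
  [set A : {set T} | [exists x, [exists y, e x y && (A == [set x; y])]]].

Definition Theta0 (T : finType) (e : rel T) : rel {set T} := fun A B =>
  [exists u, [exists v, [exists x, [exists y,
    [&& A == [set u; v], B == [set x; y] & ucycleb e [:: u; v; y; x]]]]]].

(* connect is the reflexive transitive closure. *)
Definition Theta (T : finType) (e : rel T) : rel {set T} := connect (Theta0 e).

Definition Theta_classes (T : finType) (e : rel T) : {set {set {set T}}} :=
  equivalence_partition (Theta e) (edges e).

Definition remove_edges (T : finType) (e : rel T) (C : {set {set T}}) : rel T :=
  fun x y => e x y && ([set x; y] \notin C).

Definition halfspaces (T : finType) (e : rel T) (C : {set {set T}}) :
    {set {set T}} :=
  equivalence_partition (connect (remove_edges e C)) [set: T].

Definition orthogonal (T : finType) (e : rel T) (C D : {set {set T}}) : bool :=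
  [exists u, [exists v, [exists x, [exists y,
    [&& ucycleb e [:: u; v; y; x],
        [set u; v] \in C, [set x; y] \in C,
        [set u; x] \in D & [set v; y] \in D]]]]].

Definition POF (T : finType) (e : rel T) (F : {set {set {set T}}}) : Prop :=
  F \subset Theta_classes e
  /\ {in F &, forall C D, C != D -> orthogonal e C D}.

Definition signature (T : finType) (e : rel T) (u v : T) :
    {set {set {set T}}} :=
  [set C in Theta_classes e
     | pblock (halfspaces e C) u != pblock (halfspaces e C) v].

Definition ladder_set (T : finType) (e : rel T) (u v : T) :
    {set {set {set T}}} :=
  [set C in signature e u v | [exists w, e u w && ([set u; w] \in C)]].

(* A path is given by its start u and the sequence p of its other vertices. *)
Definition shortest_path (T : finType) (e : rel T) (u v : T) (p : seq T) :
    Prop :=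
  [/\ path e u p, last u p = v & size p = dist e u v].

Definition path_edges (T : finType) (u : T) (p : seq T) : seq {set T} :=
  pairmap (fun x y => [set x; y]) u p.

(* Main.v *)
(** For an edge uw, call an edge crossing if one endpoint is closer to u and the
    other closer to w.  If xy is crossing, no other edge at x is crossing:
    otherwise two applications of the quadrangle condition produce a K_{2,3},
    whose two-vertex side consists of two medians of the same triple.  Hence a 4-cycle
    with one crossing edge has the opposite edge crossing, so the whole
    Theta-class of uw crosses.  A vertex closer to u than to w is joined to u by
    a geodesic without crossing edges; so if the class of uw separates u from v,
    then w lies on a geodesic from u to v.  Two ladder edges uw and uw' thus
    close up, by the quadrangle condition towards v, to a 4-cycle u w m w'.  This
    gives orthogonality, and it also shows that all ladder classes except that
    of uw are still ladder classes at w, so the path is built greedily. *)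

Require Import Defs.
From mathcomp Require Import all_boot.
From mathcomp Require Import zify.
Set Implicit Arguments.
Unset Strict Implicit.
Unset Printing Implicit Defensive.

(** * Distance, halfspaces and Theta-classes in a connected graph *)

Section ConnectedGraph.

Variables (T : finType) (e : rel T).
Hypotheses (e_sym : symmetric e) (e_conn : forall x y : T, connect e x y).

Local Notation d := (dist e).

(** A duplicate-free path has fewer than [#|T|] edges, so the search in [dist] succeeds and never
    falls back on its default [#|T|]. *)
Lemma dist_path x y : exists p : seq T, shortest_path e x y p.
Proof.
have [q eq_q last_q] := connectP (e_conn x y).
case: (shortenP eq_q) last_q => p e_p uniq_p _ last_p.
have size_p : size p < #|T|.
  by have := max_card [in x :: p]; rewrite (card_uniqP uniq_p).
pose P n := [exists p : n.-tuple T, path e x p && (last x p == y)].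
have hasP : has P (iota 0 #|T|).
  apply/hasP; exists (size p); first by rewrite mem_iota.
  by apply/existsP; exists (in_tuple p); rewrite /= e_p last_p eqxx.
have := nth_find 0 hasP.
rewrite nth_iota ?add0n; last by move: hasP; rewrite has_find size_iota.
case/existsP=> r /andP[e_r /eqP last_r].
by exists r; split=> //; rewrite size_tuple.
Qed.

Lemma dist_le_size x y (p : seq T) : path e x p -> last x p = y -> d x y <= size p.
Proof.
move=> e_p last_p; rewrite leqNgt; apply/negP=> lt_p.
have le_T : d x y <= #|T| by rewrite (leq_trans (find_size _ _)) ?size_iota.
have := before_find 0 lt_p; rewrite nth_iota ?add0n; last exact: leq_trans le_T.
move/negbT/negP; apply; apply/existsP; exists (in_tuple p) => /=.
by rewrite e_p last_p eqxx.
Qed.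

Lemma dist_le_sym x y : d y x <= d x y.
Proof.
have [p [e_p last_p <-]] := dist_path x y.
have := @dist_le_size y x (rev (belast x p)); rewrite size_rev size_belast.
apply.
  by rewrite -last_p rev_path (eq_path (e' := e)) // => a b /=; rewrite e_sym.
by case: p {e_p} last_p => //= a s _; rewrite rev_cons last_rcons.
Qed.

Lemma distC x y : d x y = d y x.
Proof. by apply/eqP; rewrite eqn_leq !dist_le_sym. Qed.

Lemma dist_triangle y x z : d x z <= d x y + d y z.
Proof.
have [p [e_p last_p <-]] := dist_path x y.
have [q [e_q last_q <-]] := dist_path y z.
rewrite -size_cat; apply: dist_le_size; last by rewrite last_cat last_p.
by rewrite cat_path e_p last_p.
Qed.

Lemma dist_eq0 x y : (d x y == 0) = (x == y).
Proof.
apply/eqP/eqP => [d0 | ->].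
  by have [[|? ?] [_ last_p]] := dist_path x y; rewrite d0.
by apply/eqP; rewrite -leqn0; apply: (@dist_le_size y y [::]).
Qed.

Lemma dist_refl x : d x x = 0.
Proof. by apply/eqP; rewrite dist_eq0. Qed.

Lemma dist1_edge x y : d x y = 1 -> e x y.
Proof.
by have [[|a [|b p]] [/= e_p <- <-]] := dist_path x y => //; rewrite andbT in e_p.
Qed.

Lemma edge_dist_le1 x y : e x y -> d x y <= 1.
Proof. by move=> exy; apply: (@dist_le_size x y [:: y]); rewrite //= exy. Qed.

Lemma connect_remove_edges_sym C : connect_sym (remove_edges e C).
Proof.
by apply: sym_connect_sym => x y; rewrite /remove_edges e_sym setUC.
Qed.

Lemma pblock_halfspaces C x y :
  connect (remove_edges e C) x y ->
  pblock (halfspaces e C) x = pblock (halfspaces e C) y.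
Proof.
move=> cxy.
have eqR : {in [set: T] & &, equivalence_rel (connect (remove_edges e C))}.
  move=> a b c _ _ _; split=> [|cab]; first exact: connect0.
  exact: (same_connect (@connect_remove_edges_sym C)).
apply: same_pblock.
  by have /and3P[] := equivalence_partitionP eqR.
rewrite pblock_equivalence_partition ?inE //.
by rewrite connect_remove_edges_sym.
Qed.

Lemma mem_edges x y : e x y -> [set x; y] \in edges e.
Proof.
move=> exy; rewrite inE; apply/existsP; exists x; apply/existsP; exists y.
by rewrite exy eqxx.
Qed.

Lemma Theta0_cycle a b c f :
  e a b -> e b c -> e c f -> e f a -> a != c -> b != f ->
  irreflexive e -> Theta0 e [set a; b] [set f; c].
Proof.
move=> ab bc cf fa ac bf irr.
have neq x y : e x y -> x != y by apply: contraTneq => ->; rewrite irr.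
apply/existsP; exists a; apply/existsP; exists b; apply/existsP; exists f.
apply/existsP; exists c; rewrite !eqxx /ucycleb /= !inE ab bc cf fa !negb_or.
by rewrite ac bf !neq // e_sym.
Qed.

Lemma Theta0_sym : symmetric (Theta0 e).
Proof.
suff imp A B : Theta0 e A B -> Theta0 e B A by move=> A B; apply/idP/idP; apply: imp.
case/existsP=> a /existsP[b /existsP[c /existsP[f /and3P[/eqP-> /eqP->]]]].
case/andP=> /= /and5P[ab bf fc ca _] /and4P[]; rewrite !inE !negb_or.
case/and3P=> nab naf nac /andP[nbf nbc] nfc _.
apply/existsP; exists c; apply/existsP; exists f; apply/existsP; exists a.
apply/existsP; exists b; rewrite !eqxx /ucycleb /= !inE !negb_or.
rewrite e_sym fc e_sym bf e_sym ab e_sym ca /=.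
by rewrite ![f == _]eq_sym ![c == _]eq_sym nbf naf nfc nac nbc eq_sym nab.
Qed.

Lemma Theta_equivalence : {in edges e & &, equivalence_rel (Theta e)}.
Proof.
have sym : connect_sym (Theta0 e) by apply: sym_connect_sym Theta0_sym.
by move=> A B C _ _ _; split=> [|AB]; [apply: connect0 | apply: same_connect].
Qed.

(** The classes partition [edges e], so any member [A] serves as a representative of its class. *)
Lemma mem_Theta_class C A B :
  C \in Theta_classes e -> A \in C -> (B \in C) = (B \in edges e) && Theta e A B.
Proof.
move=> ClC AC; have partE := equivalence_partitionP Theta_equivalence.
have trivE : trivIset (Theta_classes e) by case/and3P: partE.
have subE D : D \in C -> D \in edges e.
  by move=> DC; rewrite -(cover_partition partE); apply/bigcupP; exists C.
case: (boolP (B \in edges e)) => [EB|nEB] /=; last first.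
  by apply: contraNF nEB; apply: subE.
rewrite -(pblock_equivalence_partition Theta_equivalence) ?(subE _ AC) //.
by rewrite (def_pblock trivE ClC AC).
Qed.

Lemma Theta_class_eq C D A :
  C \in Theta_classes e -> D \in Theta_classes e -> A \in C -> A \in D -> C = D.
Proof.
move=> ClC ClD AC AD; apply/setP=> B.
by rewrite (mem_Theta_class B ClC AC) (mem_Theta_class B ClD AD).
Qed.

End ConnectedGraph.

(** * Metric properties of median graphs *)

Section MedianGraph.

Variables (T : finType) (e : rel T).
Hypothesis medG : median_graph e.

Local Notation d := (dist e).

Let e_sym : symmetric e. Proof. by case: medG. Qed.
Let e_irr : irreflexive e. Proof. by case: medG. Qed.
Let e_conn x y : connect e x y. Proof. by case: medG. Qed.

Local Notation distC := (distC e_sym e_conn).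
Local Notation dist_eq0 := (dist_eq0 e_conn).
Local Notation triangle := (dist_triangle e_conn).

Lemma median_exists x y z : exists m,
  [/\ d x m + d m y = d x y, d y m + d m z = d y z & d z m + d m x = d z x].
Proof.
case: medG => _ _ _ /(_ x y z)/eqP/cards1P[m /setP/(_ m)].
rewrite !inE eqxx => /andP[/andP[/eqP ? /eqP ?] /eqP ?].
by exists m.
Qed.

Lemma median_unique x y z m m' :
  d x m + d m y = d x y -> d y m + d m z = d y z -> d z m + d m x = d z x ->
  d x m' + d m' y = d x y -> d y m' + d m' z = d y z ->
  d z m' + d m' x = d z x -> m = m'.
Proof.
case: medG => _ _ _ /(_ x y z)/eqP/cards1P[n /setP def_n] h1 h2 h3 h4 h5 h6.
have := def_n m; have := def_n m'; rewrite !inE h1 h2 h3 h4 h5 h6 !eqxx.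
by move/esym/eqP=> -> /esym/eqP.
Qed.

Lemma dist_edge x y : e x y -> d x y = 1.
Proof.
move=> exy; apply/eqP; rewrite eqn_leq edge_dist_le1 //= lt0n dist_eq0.
by apply: contraTneq exy => ->; rewrite e_irr.
Qed.

(** The median of [z], [x], [y] lies on the edge [xy], hence is [x] or [y]; that endpoint is on a
    geodesic from [z] to the other one. *)
Lemma dist_edge_end z x y : e x y -> d z x = (d z y).+1 \/ d z y = (d z x).+1.
Proof.
move=> exy; have dxy := dist_edge exy.
have [m [h1 h2 h3]] := median_exists z x y.
have : (d x m == 0) || (d m y == 0) by lia.
have := triangle x z y; have := triangle y z x.
have := distC x y; have := distC z x; have := distC z y.
by rewrite !dist_eq0 => ? ? ? ? ? /orP[]/eqP ?; subst m; lia.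
Qed.

Lemma dist_common_neighbor x y t : e x y -> e x t -> y != t -> d y t = 2.
Proof.
move=> exy ext; rewrite -dist_eq0 => yt.
have := triangle x y t; have := distC x y.
have := dist_edge_end y ext; have := dist_edge exy; have := dist_edge ext.
lia.
Qed.

(** Take for [s] the median of [z], [y], [t]: since [y] and [t] are at distance 2 and equally far
    from [z], it is adjacent to both. *)
Lemma quadrangle z x y t :
  e x y -> e x t -> y != t -> d z x = (d z y).+1 -> d z x = (d z t).+1 ->
  exists s, [/\ e s y, e s t & d z y = (d z s).+1].
Proof.
move=> exy ext yt dy dt; have dyt := dist_common_neighbor exy ext yt.
have [s [h1 h2 h3]] := median_exists z y t.
have := (distC t s, distC s z, distC t z, distC s y) => -[[[? ?] ?] ?].
by exists s; split; [apply: dist1_edge | apply: dist1_edge |] => //; lia.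
Qed.

(** The vertices [y], [t], [r] are pairwise at distance 2, so [x] and [s] are both medians of
    them. *)
Lemma no_K23 x s y t r :
  x != s -> y != t -> y != r -> t != r ->
  e x y -> e x t -> e x r -> e s y -> e s t -> e s r -> False.
Proof.
move=> /eqP xs yt yr tr xy xt xr sy st sr; apply: xs.
have := dist_common_neighbor xy xt yt; have := dist_common_neighbor xy xr yr.
have := dist_common_neighbor xt xr tr; have := distC r y.
have := dist_edge xy; have := dist_edge xt; have := dist_edge xr.
have := dist_edge sy; have := dist_edge st; have := dist_edge sr.
have := (distC x, distC s) => -[dx ds].
rewrite !dx !ds => *; apply: (@median_unique y t r); rewrite ?dx ?ds; lia.
Qed.

(** * Edges crossing between the two sides of an edge [uw] *)

Lemma crossing_edge_unique u w x y t :
  e u w -> e x y -> d x u < d x w -> d y w < d y u -> e x t -> t != y ->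
  d t u < d t w.
Proof.
move=> uw xy sx sy xt ty; rewrite ltnNge; apply/negP=> st.
have := dist_edge_end x uw; have := dist_edge_end y uw; have := dist_edge_end t uw.
have := dist_edge_end u xy; have := dist_edge_end w xy.
have := dist_edge_end u xt; have := dist_edge_end w xt.
rewrite !(distC _ u) !(distC _ w) in sx sy st *.
move=> h1 h2 h3 h4 h5 h6 h7.
(* With [t] on the side of [w], both [y] and [t] are one step closer to [w] than [x] is. *)
have [s [sy' st' ds]] : exists s, [/\ e s y, e s t & d w y = (d w s).+1].
  by apply: (quadrangle xy xt); rewrite 1?eq_sym //; lia.
have := dist_edge_end u sy'; have := dist_edge_end s uw.
rewrite !(distC _ u) !(distC _ w) => h8 h9.
have xs : x != s by apply/eqP=> xs; subst s; lia.
(* Now [x] and [s] are both one step closer to [u] than [y] is, and [r] becomes the third common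
   neighbor of [x] and [s]. *)
have [r [rx rs dr]] : exists r, [/\ e r x, e r s & d u x = (d u r).+1].
  by apply: (@quadrangle u y x s); rewrite 1?e_sym //; lia.
apply: (@no_K23 x s y t r) => //; rewrite 1?e_sym // 1?eq_sym //.
  by apply/eqP=> ?; subst r; lia.
by apply/eqP=> ?; subst r; lia.
Qed.

(** This is Djokovic's relation to the edge [uw]. The ordered witnesses record which end lies on
    which side, which [[set x; y]] forgets. *)
Definition crosses u w (A : {set T}) :=
  exists x y, [/\ A = [set x; y], e x y, d x u < d x w & d y w < d y u].

(** Each end of the opposite edge is placed by [crossing_edge_unique], used once as stated and once
    with [u] and [w] exchanged. *)
Lemma crosses_Theta0 u w A B :
  e u w -> Theta0 e A B -> crosses u w A -> crosses u w B.
Proof.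
move=> uw /existsP[a /existsP[b /existsP[c /existsP[f /and3P[/eqP-> /eqP->]]]]].
case/andP=> /= /and5P[ab bf fc ca _] /and4P[]; rewrite !inE !negb_or.
case/and3P=> nab naf nac /andP[nbf nbc] nfc _ [x [y [eqA xy sx sy]]].
have wu : e w u by rewrite e_sym.
have ac : e a c by rewrite e_sym.
have ba : e b a by rewrite e_sym.
have : x \in [set a; b] by rewrite eqA !inE eqxx.
have : y \in [set a; b] by rewrite eqA !inE eqxx orbT.
have nxy : x != y by apply: contraTneq xy => ->; rewrite e_irr.
rewrite !inE => /orP[]/eqP eqy /orP[]/eqP eqx; subst x y; rewrite ?eqxx // in nxy.
- exists f, c; split=> //; first by rewrite setUC.
    by apply: (crossing_edge_unique uw xy) => //; rewrite eq_sym.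
  by apply: (crossing_edge_unique wu ab) => //; rewrite eq_sym.
- exists c, f; split=> //; first by rewrite e_sym.
    by apply: (crossing_edge_unique uw xy) => //; rewrite eq_sym.
  by apply: (crossing_edge_unique wu ba) => //; rewrite eq_sym.
Qed.

Lemma crosses_Theta u w A : e u w -> Theta e [set u; w] A -> crosses u w A.
Proof.
move=> uw /connectP[p pth ->].
have : crosses u w [set u; w].
  by exists u, w; split=> //; rewrite dist_refl // dist_edge // e_sym.
elim: p [set u; w] pth => //= B p IHp A' /andP[AB pth] crA.
by apply: IHp pth _; apply: crosses_Theta0 AB crA.
Qed.

(** * From separation by a Theta-class to distances *)

Section Class.

Variables (C : {set {set T}}) (u w : T).
Hypotheses (ClC : C \in Theta_classes e) (uw : e u w) (uwC : [set u; w] \in C).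

Lemma class_crosses A : A \in C -> crosses u w A.
Proof.
by rewrite (mem_Theta_class e_sym A ClC uwC) => /andP[_]; apply: crosses_Theta.
Qed.

Lemma connect_side x :
  d x u < d x w -> connect (remove_edges e C) u x.
Proof.
rewrite connect_remove_edges_sym //.
have [n] := ubnP (d x u); elim: n x => // n IHn x; rewrite ltnS => le_n sx.
have [p [e_p last_p size_p]] := dist_path e_conn x u.
case: p e_p last_p size_p => [_ /= ->|y p /= /andP[xy e_p] last_p size_p].
  by rewrite connect0.
have d_y := dist_le_size e_p last_p.
(* Along the geodesic the distance to [u] drops by one, while the distance to [w] drops by at most
   one. *)
have sy : d y u < d y w by have := triangle y x w; have := dist_edge xy; lia.
apply: connect_trans (IHn y _ sy); last by lia.
(* An edge of [C] would have an end on the side of [w], but [x] and [y] are both on the side of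
   [u]. *)
apply/connect1/andP; split=> //; apply/negP=> /class_crosses[a [b [/setP eqA _ sa sb]]].
have := eqA b; rewrite !inE eqxx orbT => /orP[]/eqP ?; subst b; lia.
Qed.

(** Otherwise [x] would be closer to [u] and so in the halfspace of [u]. The equation makes
    [quadrangle] applicable towards [x]. *)
Lemma signature_side x :
  C \in signature e u x -> d x u = (d x w).+1.
Proof.
rewrite inE ClC /= => sgn; have [//|lt_u] := dist_edge_end x uw.
case/eqP: sgn; apply: pblock_halfspaces => //; apply: connect_side.
by rewrite lt_u.
Qed.

End Class.

(** * Ladder sets: orthogonality and the greedy path *)

Lemma ladderP C u v :
  C \in ladder_set e u v ->
  exists w, [/\ C \in Theta_classes e, e u w, [set u; w] \in C,
                C \in signature e u v & d v u = (d v w).+1].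
Proof.
rewrite inE => /andP[sgC /existsP[w /andP[uw uwC]]].
have ClC : C \in Theta_classes e by move: sgC; rewrite inE => /andP[].
by exists w; split=> //; apply: signature_side sgC.
Qed.

(** Distinct classes force [w != w'], so [quadrangle] towards [v] closes the square; its opposite
    edges are related by [Theta0]. *)
Lemma ladder_square C D u v w w' :
  C \in Theta_classes e -> e u w -> [set u; w] \in C -> d v u = (d v w).+1 ->
  D \in Theta_classes e -> e u w' -> [set u; w'] \in D -> d v u = (d v w').+1 ->
  C != D ->
  exists m, [/\ ucycleb e [:: u; w; m; w'], [set w'; m] \in C & [set w; m] \in D].
Proof.
move=> ClC uw uwC dw ClD uw' uwD dw' nCD.
have nww : w != w'.
  apply: contraNneq nCD => eqw; rewrite -eqw in uwD.
  by rewrite (Theta_class_eq e_sym ClC ClD uwC uwD).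
have [m [mw mw' dm]] := quadrangle uw uw' nww dw dw'.
(* The vertex [m] is two steps closer to [v] than [u] is. *)
have num : u != m by apply/eqP=> um; subst m; lia.
have wm : e w m by rewrite e_sym.
have w'm : e w' m by rewrite e_sym.
have wu : e w u by rewrite e_sym.
have w'u : e w' u by rewrite e_sym.
have neq x y : e x y -> x != y by apply: contraTneq => ->; rewrite e_irr.
exists m; split.
- by rewrite /ucycleb /= uw wm mw' w'u !inE !negb_or num nww !neq.
- rewrite (mem_Theta_class e_sym _ ClC uwC) mem_edges //=.
  by apply/connect1/Theta0_cycle.
- rewrite (mem_Theta_class e_sym _ ClD uwD) mem_edges //=.
  by apply/connect1/Theta0_cycle => //; rewrite eq_sym.
Qed.

Lemma ladder_POF u v : POF e (ladder_set e u v).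
Proof.
split; first by apply/subsetP=> C /ladderP[w []].
move=> C D /ladderP[w [ClC uw uwC _ dw]] /ladderP[w' [ClD uw' uwD _ dw']] nCD.
have [m [cyc mC mD]] := ladder_square ClC uw uwC dw ClD uw' uwD dw' nCD.
apply/existsP; exists u; apply/existsP; exists w; apply/existsP; exists w'.
by apply/existsP; exists m; rewrite cyc uwC mC uwD mD.
Qed.

(** The square supplies an edge of [D] at [w]. The edge [uw] is not in [D], so [u] and [w] share a
    halfspace of [D], and [D] still separates [w] from [v]. *)
Lemma ladder_step C D u v w :
  C \in Theta_classes e -> e u w -> [set u; w] \in C -> d v u = (d v w).+1 ->
  D \in ladder_set e u v -> C != D -> D \in ladder_set e w v.
Proof.
move=> ClC uw uwC dw /ladderP[w' [ClD uw' uwD sgD dw']] nCD.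
have [m [cyc mC mD]] := ladder_square ClC uw uwC dw ClD uw' uwD dw' nCD.
rewrite inE; apply/andP; split; last first.
  by apply/existsP; exists m; rewrite mD andbT; case/andP: cyc => /= /and3P[].
move: sgD; rewrite !inE ClD /=.
suff /(pblock_halfspaces e_sym) -> : connect (remove_edges e D) u w by [].
apply/connect1/andP; split=> //; apply: contra nCD => uwD'.
by rewrite (Theta_class_eq e_sym ClC ClD uwC uwD').
Qed.

(** Stated for any subset [F], because the ladder set at [w] may contain new classes: the induction
    follows [F :\ C] only. *)
Lemma ladder_path (F : {set {set {set T}}}) u v :
  F \subset ladder_set e u v ->
  exists p : seq T,
    [/\ shortest_path e u v p, #|F| <= size p
      & forall A, A \in take #|F| (path_edges u p) ->
          exists2 C, C \in F & A \in C].
Proof.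
have [n] := ubnP #|F|; elim: n F u => // n IHn F u; rewrite ltnS => leF subF.
have [->|[C CF]] := set_0Vmem F.
  have [p sp] := dist_path e_conn u v.
  by exists p; split=> //; rewrite cards0 // take0.
have [w [ClC uw uwC _ dw]] := ladderP (subsetP subF C CF).
have cardF : #|F| = #|F :\ C|.+1 by rewrite (cardsD1 C F) CF.
have [||p [[e_p last_p size_p] le_p edges_p]] := IHn (F :\ C) w.
- by rewrite -cardF.
- apply/subsetP=> D; rewrite in_setD1 => /andP[nDC /(subsetP subF) DL].
  by apply: ladder_step ClC uw uwC dw DL _; rewrite eq_sym.
exists (w :: p); rewrite cardF; split=> //.
  split=> //=; first by rewrite uw.
  (* Prepending [uw] keeps the path shortest, since [w] is one step closer to [v]. *)
  by rewrite size_p -[RHS]distC dw distC.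
move=> A; rewrite /= inE => /orP[/eqP-> | /edges_p[D]]; first by exists C.
by rewrite inE => /andP[_ DF] AD; exists D.
Qed.

End MedianGraph.

Theorem theorem4 (T : finType) (e : rel T) (v0 u v : T) :
  median_graph e ->
  u \in interval e v0 v ->
  POF e (ladder_set e u v) /\
  exists p : seq T,
    [/\ shortest_path e u v p,
        #|ladder_set e u v| <= size p
      & forall A : {set T},
          A \in take #|ladder_set e u v| (path_edges u p) ->
          exists2 C : {set {set T}}, C \in ladder_set e u v & A \in C].
Proof. by move=> medG _; split; [apply: ladder_POF | apply: ladder_path]. Qed.
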